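(* Let the full-batch loss $E:\mathbb{R}^p\to\mathbb{R}$ be smooth and 4-times differentiable. Then the heavy-ball momentum gradient descent (GD+M) updates $$\mathbf{x}^{k+1}=\mathbf{x}^k-h\nabla E(\mathbf{x}^k)+\beta(\mathbf{x}^k-\mathbf{x}^{k-1}),\qquad k=1,2,\dots,n,$$ are $O(h^2)$ close to the continuous trajectory $\widetilde{\mathbf{x}}$ of the piecewise first-order ODE $$\widetilde{\mathbf{x}}'(t)=-\frac{1-\beta^{k+1}}{1-\beta}\nabla E(\widetilde{\mathbf{x}}(t))-\frac{h\gamma(1+\beta)}{2(1-\beta)^3}\nabla^2E(\widetilde{\mathbf{x}}(t))\nabla E(\widetilde{\mathbf{x}}(t)),\qquad t\in[t_k,t_{k+1}],$$ where $t_k=kh$ and $$\gamma=(1-\beta^{2k+2})-4(k+1)\beta^{k+1}\frac{1-\beta}{1+\beta}.$$ Since $\beta^k$ quickly decays to $0$ as $k$ grows, for a sufficiently large iteration $k$ this ODE reduces to $$\widetilde{\mathbf{x}}'(t)=-\frac{1}{1-\beta}\nabla\hat E(\widetilde{\mathbf{x}}(t)),\qquad t\in[0,T],$$ driven by the modified loss $$\hat E(\widetilde{\mathbf{x}}(t)):=E(\widetilde{\mathbf{x}}(t))+\frac{(1+\beta)h}{4(1-\beta)^2}\|\nabla E(\widetilde{\mathbf{x}}(t))\|_2^2 .$$ More specifically, for a fixed time $T$ there exists a constant $C$ such that for any learning rate $0<h<T$, $$\|\widetilde{\mathbf{x}}(t_k)-\mathbf{x}^k\|_2\le Ch^2,\qquad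 t_k=kh,\quad k=1,2,\dots,\lfloor T/h\rfloor .$$
   Context: $h$ is the learning rate (step size) and $\beta\in[0,1)$ the momentum parameter. $\nabla E$ and $\nabla^2E$ denote the gradient and Hessian of $E$; $\|\cdot\|_2$ is the Euclidean norm. The updates and the continuous trajectory set off from the same point, $\widetilde{\mathbf{x}}(0)=\mathbf{x}^0$, and the first heavy-ball step is a plain gradient step, $\mathbf{x}^1=\mathbf{x}^0-h\nabla E(\mathbf{x}^0)$ (that is, $\mathbf{x}^{-1}=\mathbf{x}^0$). For fixed $T>0$, discrete updates $\mathbf{x}^k$ and a continuous trajectory $\widetilde{\mathbf{x}}$ are ''$O(h^\alpha)$ close'' if $\max_{1\le k\le\lfloor T/h\rfloor}\|\mathbf{x}^k-\widetilde{\mathbf{x}}(t_k)\|_2\le ch^\alpha$ with $c$ a constant independent of $h$ and $k$. The same symbol $\widetilde{\mathbf{x}}$ is used for the trajectory of the piecewise ODE and of the reduced ODE.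
   Formalization: The bound is proved for the piecewise-ODE trajectory, assuming E has Lipschitz gradient or the trajectories stay in one ball for all 0<h<T; for merely smooth E it fails (E=-x^4, β=0, x^0=1, T=1). ''Reduces to'' is read as uniform convergence of the right-hand sides on compact sets. *)

(* Defs.v *)
From HB Require Import structures.
From mathcomp Require Import all_boot all_order all_algebra.
From mathcomp Require Import all_classical all_reals all_analysis.
Set Implicit Arguments.
Unset Strict Implicit.
Unset Printing Implicit Defensive.
Import Order.TTheory GRing.Theory Num.Theory.
Import numFieldNormedType.Exports.
Local Open Scope classical_set_scope.
Local Open Scope ring_scope.

Section calculus.
Context {R : realType} {p : nat}.
Implicit Types (E : 'rV[R]_p -> R) (x : 'rV[R]_p).

(* The library norm on matrices is the sup norm. *)
Definition norm2 x : R := Num.sqrt (\sum_(i < p) x 0 i ^+ 2).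

Definition partial (i : 'I_p) E : 'rV[R]_p -> R := 'D_(delta_mx 0 i) E.

(* n-fold Frechet differentiability on the whole space; in finite dimension
   the differential of E is determined by the partial derivatives of E, so it
   is differentiable exactly when each of them is. *)
Fixpoint times_differentiable (n : nat) E : Prop :=
  if n is m.+1 then
    (forall x, differentiable E x) /\
    (forall i, times_differentiable m (partial i E))
  else True.

Definition grad E x : 'rV[R]_p := \row_(i < p) partial i E x.

(* The jacobian acts on row vectors from the right, so that the product of the
   Hessian with a vector v is [v *m hess E x]. *)
Definition hess E x : 'M[R]_p := 'J (grad E) x.

(* Smoothness in the sense of optimization: the gradient is Lipschitz. *)
Definition lipschitz_smooth E : Prop :=
  exists L : R, forall x y, norm2 (grad E x - grad E y) <= L * norm2 (x - y).

End calculus.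

Section momentum.
Context {R : realType} {p : nat}.
Implicit Types (E : 'rV[R]_p -> R) (beta h T : R) (x : 'rV[R]_p) (k : nat).

Fixpoint heavy_ball E beta x0 h k : 'rV[R]_p :=
  if k is j.+1 then
    let xj := heavy_ball E beta x0 h j in
    let xprev := if j is i.+1 then heavy_ball E beta x0 h i else x0 in
    xj - h *: grad E xj + beta *: (xj - xprev)
  else x0.

Definition gamma beta k : R :=
  (1 - beta ^+ (2 * k + 2)) -
  4 * k.+1%:R * beta ^+ k.+1 * ((1 - beta) / (1 + beta)).

Definition piecewise_field E beta h k x : 'rV[R]_p :=
  - ((1 - beta ^+ k.+1) / (1 - beta)) *: grad E x
  - (h * gamma beta k * (1 + beta) / (2 * (1 - beta) ^+ 3)) *:
      (grad E x *m hess E x).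

Definition modified_loss E beta h x : R :=
  E x + (1 + beta) * h / (4 * (1 - beta) ^+ 2) * norm2 (grad E x) ^+ 2.

Definition reduced_field E beta h x : 'rV[R]_p :=
  - (1 / (1 - beta)) *: grad (modified_loss E beta h) x.

Definition nsteps T h : nat := Num.truncn (T / h).

Definition time h k : R := k%:R * h.

(* [xt] is a continuous solution on [0, time h (nsteps T h)]. On the interval
   [time h k, time h k.+1] the ODE is imposed in the interior; since the
   field is continuous there, the one-sided equations at the endpoints follow.
   The field jumps at the grid points, where [xt] need not be differentiable. *)
Definition piecewise_trajectory E beta T x0 h (xt : R -> 'rV[R]_p) : Prop :=
  xt 0 = x0 /\
  forall k, (k < nsteps T h)%N ->
    derivable_oo_LRcontinuous xt (time h k) (time h k.+1) /\
    {in `]time h k, time h k.+1[, forall t,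
      derive1 xt t = piecewise_field E beta h k (xt t)}.

Definition uniformly_bounded T (xt : R -> R -> 'rV[R]_p) : Prop :=
  exists M : R, forall h t, 0 < h < T -> 0 <= t <= time h (nsteps T h) ->
    norm2 (xt h t) <= M.

(* The iterates [xs h] and the trajectories [xt h] are indexed by the step
   size, and the constant is uniform in it. *)
Definition bigO_close (alpha : nat) T
    (xs : R -> nat -> 'rV[R]_p) (xt : R -> R -> 'rV[R]_p) : Prop :=
  exists C : R, forall h, 0 < h < T ->
    forall k, (1 <= k <= nsteps T h)%N ->
      norm2 (xt h (time h k) - xs h k) <= C * h ^+ alpha.

(* The k-th piecewise field tends to the reduced one as k grows, uniformly on
   compact sets and uniformly in the step size. *)
Definition reduces_to_modified_loss E beta T : Prop :=
  forall A : set 'rV[R]_p, compact A -> forall eps : R, 0 < eps ->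
    \forall k \near \oo, forall h x, 0 < h < T -> A x ->
      norm2 (piecewise_field E beta h k x - reduced_field E beta h x) <= eps.

End momentum.

(* Main.v *)
(* Write f for the gradient of E and G = D f f. In each step the field is
   - a f - h b G with coefficients a, b depending on the step; a second order
   Taylor expansion of the flow, forward from t_(k+1) and backward from
   t_(k+1), shows that its defect in the heavy-ball recursion is O(h^3), because
   the coefficients satisfy a_(k+1) = 1 + beta a_k and
   b_(k+1) = beta b_k + (a_(k+1)^2 + beta a_k^2) / 2. Stability follows from a
   discrete Gronwall argument for e_(k+1) - beta e_k, where e is the error; the
   Lipschitz constants are those of a ball around the trajectories, which the
   iterates cannot leave as long as C h^2 <= 1. For larger h the number of
   steps is bounded, and so is the error.
   The reduced field is the limit of the coefficients, the symmetry of the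
   Hessian identifying G with half the gradient of the squared norm of f. *)
Require Import Defs.
From mathcomp Require Import all_boot all_order all_algebra.
From mathcomp Require Import all_classical all_reals all_analysis.
From mathcomp Require Import ring lra.
Import Order.TTheory GRing.Theory Num.Theory.
Import numFieldNormedType.Exports.
Local Open Scope ring_scope.
Set Implicit Arguments.
Unset Strict Implicit.
Unset Printing Implicit Defensive.

(** * Comparison of the sup norm with the Euclidean norm *)

Section sup_norm.
Context {R : realType} {p : nat}.
Implicit Types x : 'rV[R]_p.

Lemma coord_le_norm x i : `|x 0 i| <= `|x|.
Proof.
rewrite [leRHS]/Num.Def.normr/= mx_normrE.
exact: (le_bigmax _ (fun ij => `|x ij.1 ij.2|) (0, i)).
Qed.

Lemma norm_le_coord x c : 0 <= c -> (forall i, `|x 0 i| <= c) -> `|x| <= c.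
Proof.
move=> c0 xc; rewrite [leLHS]/Num.Def.normr/= mx_normrE.
by apply: bigmax_le => // -[i j] _ /=; rewrite ord1.
Qed.

Lemma norm2_ge0 x : 0 <= norm2 x.
Proof. exact: sqrtr_ge0. Qed.

Lemma norm_le_norm2 x : `|x| <= norm2 x.
Proof.
apply: norm_le_coord => [|i]; first exact: norm2_ge0.
rewrite -sqrtr_sqr ler_wsqrtr// (bigD1 i)//= lerDl.
by apply: sumr_ge0 => j _; exact: sqr_ge0.
Qed.

(** The constant p, cruder than its square root, keeps later constants free of roots; it rests on p
    <= p^2. *)
Lemma norm2_le_norm x : norm2 x <= p%:R * `|x|.
Proof.
have px0 : 0 <= p%:R * `|x| by rewrite mulr_ge0.
rewrite -(ger0_norm px0) -sqrtr_sqr ler_wsqrtr// exprMn.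
apply: (@le_trans _ _ (p%:R * `|x| ^+ 2)).
  have -> : p%:R * `|x| ^+ 2 = \sum_(i < p) `|x| ^+ 2.
    by rewrite sumr_const card_ord mulr_natl.
  apply: ler_sum => i _.
  by rewrite -real_normK ?num_real// lerXn2r ?nnegrE// coord_le_norm.
rewrite ler_wpM2r ?sqr_ge0// -natrX ler_nat.
by rewrite expnS expn1; case: (p) => // n; rewrite leq_pmulr.
Qed.

End sup_norm.

(** * Functions that are Lipschitz on every ball *)

Section ball_lipschitz.
Context {R : realType} {p : nat}.
Implicit Types (f g : 'rV[R]_p -> R) (x y : 'rV[R]_p) (M L : R).

(** The constant may depend on the radius. This weak form is stable under products and follows from
    continuity of the partial derivatives alone. *)
Definition ball_lipschitz g : Prop := forall M, exists2 L : R, 0 <= L &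
  forall x y, `|x| <= M -> `|y| <= M -> `|g x - g y| <= L * `|x - y|.

Lemma ball_lipschitz_bounded g M : ball_lipschitz g ->
  exists2 B : R, 0 <= B & forall x, `|x| <= M -> `|g x| <= B.
Proof.
(* Values are compared with the value at the origin; the radius [|M|] puts the origin in the ball
   even for negative [M]. *)
move=> /(_ `|M|)[L L0 gL]; exists (`|g 0| + L * `|M|).
  by rewrite addr_ge0// mulr_ge0.
move=> x xM; rewrite -[g x](subrK (g 0)) addrC (le_trans (ler_normD _ _))//.
have xM' := le_trans xM (ler_norm M).
rewrite lerD2l (le_trans (gL x 0 xM' _)) ?normr0// subr0.
by rewrite ler_wpM2l.
Qed.

Lemma ball_lipschitz_cst c : ball_lipschitz (cst c).
Proof. by move=> M; exists 0 => // x y _ _; rewrite subrr normr0 mul0r. Qed.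

Lemma ball_lipschitzD f g : ball_lipschitz f -> ball_lipschitz g ->
  ball_lipschitz (fun x => f x + g x).
Proof.
move=> fl gl M; have [A A0 fA] := fl M; have [B B0 gB] := gl M.
exists (A + B) => [|x y xM yM]; first exact: addr_ge0.
by rewrite opprD addrACA (le_trans (ler_normD _ _))// mulrDl lerD ?fA ?gB.
Qed.

Lemma ball_lipschitzM f g : ball_lipschitz f -> ball_lipschitz g ->
  ball_lipschitz (fun x => f x * g x).
Proof.
move=> fl gl M; have [A A0 fA] := fl M; have [B B0 gB] := gl M.
have [C C0 fC] := ball_lipschitz_bounded M fl.
have [D D0 gD] := ball_lipschitz_bounded M gl.
exists (C * B + A * D) => [|x y xM yM]; first by rewrite addr_ge0// mulr_ge0.
have -> : f x * g x - f y * g y = f x * (g x - g y) + (f x - f y) * g y.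
  by ring.
rewrite (le_trans (ler_normD _ _))// !normrM mulrDl lerD//.
  by rewrite -mulrA ler_pM ?fC ?gB.
by rewrite mulrAC ler_pM ?fA ?gD.
Qed.

Lemma ball_lipschitz_sum (I : finType) (F : I -> 'rV[R]_p -> R) :
  (forall i, ball_lipschitz (F i)) -> ball_lipschitz (fun x => \sum_i F i x).
Proof.
move=> Fl; elim: index_enum => [|i r IH].
  by under eq_fun do rewrite big_nil; exact: ball_lipschitz_cst.
by under eq_fun do rewrite big_cons; exact: ball_lipschitzD.
Qed.

Lemma ball_lipschitz_fin (I : finType) (F : I -> 'rV[R]_p -> R) M :
  (forall i, ball_lipschitz (F i)) -> exists2 L : R, 0 <= L & forall i x y,
    `|x| <= M -> `|y| <= M -> `|F i x - F i y| <= L * `|x - y|.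
Proof.
(* Choice turns the constants into a function of the index; their sum then serves all indices at
   once. *)
move=> Fl; have {Fl} Fl i : {L : R | 0 <= L /\ forall x y,
    `|x| <= M -> `|y| <= M -> `|F i x - F i y| <= L * `|x - y|}.
  by apply: cid; have [L L0 FL] := Fl i M; exists L.
exists (\sum_i sval (Fl i)) => [|i x y xM yM].
  by apply: sumr_ge0 => i _; case: (svalP (Fl i)).
have [L0 FL] := svalP (Fl i); rewrite (le_trans (FL _ _ xM yM))//.
rewrite ler_wpM2r// (bigD1 i)//= lerDl.
by apply: sumr_ge0 => j _; case: (svalP (Fl j)).
Qed.

Lemma ball_lipschitz_fin_bounded (I : finType) (F : I -> 'rV[R]_p -> R) M :
  (forall i, ball_lipschitz (F i)) ->
  exists2 B : R, 0 <= B & forall i x, `|x| <= M -> `|F i x| <= B.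
Proof.
move=> /(@ball_lipschitz_fin _ _ `|M|)[L L0 FL].
exists (\sum_i `|F i 0| + L * `|M|).
  by rewrite addr_ge0 ?mulr_ge0// sumr_ge0.
move=> i x xM; have {}xM := le_trans xM (ler_norm M).
rewrite -[F i x](subrK (F i 0)) addrC (le_trans (ler_normD _ _))// lerD//.
  by rewrite (bigD1 i)//= lerDl sumr_ge0.
by rewrite (le_trans (FL i x 0 xM _)) ?normr0// subr0 ler_wpM2l.
Qed.

End ball_lipschitz.

(** * Chain rule and mean value theorem along segments *)

Section chain_rule.
Context {R : realType} {p : nat}.
Implicit Types (g : 'rV[R]_p -> R) (x v : 'rV[R]_p).

Lemma diff_partial g x v : differentiable g x ->
  'd g x v = \sum_i v 0 i * partial i g x.
Proof.
move=> gx; rewrite {1}[v]row_sum_delta linear_sum/=; apply: eq_bigr => i _.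
by rewrite linearZ/= -deriveE.
Qed.

Lemma is_derive_comp_row g (y : R -> 'rV[R]_p) t v :
  differentiable g (y t) -> is_derive t 1 y v ->
  is_derive t 1 (g \o y) (\sum_i v 0 i * partial i g (y t)).
Proof.
move=> gy yv; have yd : differentiable y t by exact/derivable1_diffP.
have gyd : differentiable (g \o y) t by exact: differentiable_comp.
apply: DeriveDef; first exact/derivable1_diffP.
have Dy : 'D_1 y t = v by case: yv.
by rewrite deriveE// diff_comp//= -(deriveE _ yd) Dy diff_partial.
Qed.

Lemma is_derive_line x v (t : R) :
  is_derive t 1 (fun s : R => x + s *: v) v.
Proof.
have h : is_diff t (cst x + ( *:%R^~ v)) (0 + ( *:%R^~ v)) by exact: is_diffD.
have d : differentiable (fun s : R => x + s *: v) t by case: h.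
apply: DeriveDef; first exact/derivable1_diffP.
by rewrite deriveE//; case: h => _; rewrite /GRing.add/= => ->; rewrite /= add0r scale1r.
Qed.

Lemma MVT_line g x v : (forall z, differentiable g z) ->
  exists2 c : R, 0 < c < 1 & g (x + v) - g x = 'd g (x + c *: v) v.
Proof.
move=> gd; pose z (s : R) : 'rV[R]_p := x + s *: v.
have zd (s : R) : is_derive s 1 (g \o z) (\sum_i v 0 i * partial i g (z s)).
  by apply: is_derive_comp_row; [exact: gd|exact: is_derive_line].
have zc : {within `[0, 1], continuous (g \o z)}%classic.
  apply: continuous_subspaceT => s.
  by apply: differentiable_continuous; apply/derivable1_diffP; case: (zd s).
have [s] := MVT (@ltr01 R) (fun s _ => zd s) zc.
rewrite in_itv/= /z/= scale0r addr0 scale1r subr0 mulr1 => s01 ->.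
by exists s => //; rewrite diff_partial.
Qed.

(** A closed ball is compact, which bounds the partial derivatives on it, and convex, which keeps
    the intermediate point of the mean value theorem inside. *)
Lemma ball_lipschitz_diff g : (forall x, differentiable g x) ->
  (forall i, continuous (partial i g)) -> ball_lipschitz g.
Proof.
move=> gd gc M.
have cpt : compact [set x : 'rV[R]_p | `|x| <= M]%classic.
  apply: bounded_closed_compact.
    by exists M; split=> [|N MN x /= xM]; rewrite ?num_real// (le_trans xM)// ltW.
  have -> : [set x : 'rV[R]_p | `|x| <= M]%classic =
    (Num.norm @^-1` [set r : R | r <= M])%classic by [].
  apply: closed_comp; last exact: closed_le.
  by move=> x _; exact: norm_continuous.
have bd i : {B : R | 0 <= B /\ forall x, `|x| <= M -> `|partial i g x| <= B}.
  apply: cid.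
  have cf : {within [set x : 'rV[R]_p | `|x| <= M], continuous (partial i g)}%classic.
    exact: continuous_subspaceT.
  have /compact_bounded[B [_ Bb]] := continuous_compact cf cpt.
  (* [compact_bounded] provides as bounds only the numbers strictly above [B], hence the added 1. *)
  exists (`|B| + 1); split=> [|x xM]; first by rewrite addr_ge0.
  apply: (Bb (`|B| + 1)); last by exists x.
  by rewrite (le_lt_trans (ler_norm B))// ltrDl.
exists (\sum_i sval (bd i)) => [|x y xM yM].
  by apply: sumr_ge0 => i _; case: (svalP (bd i)).
have [s /andP[s0 s1]] := MVT_line y (x - y) gd.
rewrite [y + _]addrC subrK => ->; set z := y + _.
have zM : `|z| <= M.
  have -> : z = (1 - s) *: y + s *: x.
    by rewrite /z scalerBr scalerBl scale1r addrA addrAC.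
  rewrite (le_trans (ler_normD _ _))// !normrZ.
  rewrite (ger0_norm (ltW s0)) ger0_norm ?subr_ge0 ?(ltW s1)//.
  by nra.
rewrite diff_partial// mulr_suml (le_trans (ler_norm_sum _ _ _))// ler_sum// => i _.
rewrite normrM mulrC ler_pM// ?coord_le_norm//.
by case: (svalP (bd i)) => _; apply.
Qed.

End chain_rule.

(** * Symmetry of second partial derivatives *)

Section second_partials.
Context {R : realType} {p : nat}.
Implicit Types (g : 'rV[R]_p -> R) (x v : 'rV[R]_p).

Lemma diff_scaled_delta g x (s : R) i : differentiable g x ->
  'd g x (s *: 'e_i) = s * partial i g x.
Proof. by move=> gx; rewrite linearZ/= /partial deriveE. Qed.

(** The mean value theorem is applied twice: in direction j to the increment of [g] in direction i,
    then in direction i to [partial j g]. *)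
Lemma second_difference g i j x (s : R) : 0 < s ->
  (forall z, differentiable g z) -> (forall z, differentiable (partial j g) z) ->
  exists2 z : 'rV[R]_p, `|z - x| <= 2 * s &
    g (x + s *: 'e_i + s *: 'e_j) - g (x + s *: 'e_i) - g (x + s *: 'e_j) + g x
    = s ^+ 2 * partial i (partial j g) z.
Proof.
move=> s0 gd gjd; pose h z := g (z + s *: 'e_i) - g z.
have sd z : differentiable (fun z : 'rV[R]_p => z + s *: 'e_i) z.
  by apply: differentiableD => //; exact: differentiable_cst.
have gsd z : differentiable (fun z : 'rV[R]_p => g (z + s *: 'e_i)) z.
  exact: (@differentiable_comp _ _ _ _ (fun z => z + s *: 'e_i) g).
have hd z : differentiable h z by apply: differentiableB.
have hj z : partial j h z = partial j g (z + s *: 'e_i) - partial j g z.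
  rewrite /partial /h deriveB; [|exact: diff_derivable..].
  (* Differentiation commutes with translation: the two difference quotients agree up to
     associativity. *)
  congr (_ - _); rewrite /derive /=.
  set F := fun r : R => _; set F' := fun r : R => _; suff -> : F = F' by [].
  by apply/funext => r; rewrite /F /F' addrA.
have [c /andP[c0 c1]] := MVT_line x (s *: 'e_j) hd.
rewrite diff_scaled_delta// hj; set z := x + c *: _.
have [d /andP[d0 d1] ->] := MVT_line z (s *: 'e_i) gjd.
rewrite diff_scaled_delta// => hE.
exists (z + d *: (s *: 'e_i)).
  rewrite /z [x + _]addrC addrAC addrK (le_trans (ler_normD _ _))//.
  rewrite !normrZ (gtr0_norm c0) (gtr0_norm d0) (gtr0_norm s0).
  have le1 (k : 'I_p) : `|'e_k : 'rV[R]_p| <= 1.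
    apply: norm_le_coord => // l; rewrite mxE eqxx/=.
    by case: (_ == _); rewrite ?normr1 ?normr0.
  have := le1 i; have := le1 j; have := normr_ge0 ('e_i : 'rV[R]_p).
  have := normr_ge0 ('e_j : 'rV[R]_p).
  set u := `|'e_j : 'rV[R]_p|; set w := `|'e_i : 'rV[R]_p| => u0 w0 u1 w1.
  have cs : c * (s * u) <= s.
    rewrite -[leRHS]mul1r ler_pM ?(ltW c0) ?(ltW c1)// ?mulr_ge0 ?(ltW s0)//.
    by rewrite ler_piMr ?(ltW s0).
  have ds : d * (s * w) <= s.
    rewrite -[leRHS]mul1r ler_pM ?(ltW d0) ?(ltW d1)// ?mulr_ge0 ?(ltW s0)//.
    by rewrite ler_piMr ?(ltW s0).
  lra.
by rewrite expr2 -mulrA -hE /h [x + s *: 'e_j + s *: 'e_i]addrAC; ring.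
Qed.

(** Schwarz's theorem. The second difference is symmetric in i and j, so the two mixed partials
    agree at two points arbitrarily close to [x], and continuity carries this over to [x]. *)
Lemma partialC g i j x : (forall z, differentiable g z) ->
  (forall k z, differentiable (partial k g) z) ->
  (forall k l, continuous (partial k (partial l g))) ->
  partial i (partial j g) x = partial j (partial i g) x.
Proof.
move=> gd g1d g2c; apply/eqP; rewrite -subr_eq0 -normr_le0.
apply/ler_addgt0Pr => eps eps0; rewrite add0r.
have tri (a b c : R) :
    `|a - c| < eps / 2 -> `|b - c| < eps / 2 -> `|a - b| <= eps.
  rewrite distrC !ltr_norml => /andP[? ?] /andP[? ?].
  by rewrite ler_norml; apply/andP; split; lra.
have close k l : exists2 r : R, 0 < r & forall z : 'rV[R]_p, `|z - x| < r ->
    `|partial k (partial l g) x - partial k (partial l g) z| < eps / 2.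
  have /cvgrPdist_lt/(_ (eps / 2)) := g2c k l x.
  rewrite divr_gt0// => /(_ isT)/nbhs_ballP[r /= r0 rz]; exists r => // z zx.
  by apply: rz; rewrite -ball_normE/= distrC.
have [r r0 rz] := close i j; have [r' r'0 rz'] := close j i.
(* The intermediate points lie within 2s of [x], so a quarter keeps them strictly inside both
   balls. *)
pose s := Num.min r r' / 4.
have m0 : 0 < Num.min r r' by rewrite lt_min r0.
have s0 : 0 < s by rewrite divr_gt0.
have lts (z : 'rV[R]_p) : `|z - x| <= 2 * s -> `|z - x| < Num.min r r'.
  by move=> /le_lt_trans; apply; rewrite /s; lra.
have [z /lts zx zE] := second_difference i x s0 gd (g1d j).
have [z' /lts z'x z'E] := second_difference j x s0 gd (g1d i).
have minl : Num.min r r' <= r by rewrite ge_min lexx.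
have minr : Num.min r r' <= r' by rewrite ge_min lexx orbT.
have {}zx := rz z (lt_le_trans zx minl).
have {}z'x := rz' z' (lt_le_trans z'x minr).
have s2 : s ^+ 2 != 0 by rewrite expf_neq0// gt_eqF.
have zz' : partial i (partial j g) z = partial j (partial i g) z'.
  apply: (mulfI s2); apply: etrans (esym zE) (etrans _ z'E).
  by congr (_ + _); rewrite addrAC; congr (g _ - _ - _); rewrite addrAC.
by apply: tri zx _; rewrite zz'.
Qed.

End second_partials.

(** * Regularity of the loss and the gradient of the modified loss *)

Section loss.
Context {R : realType} {p : nat} (E : 'rV[R]_p -> R).
Hypothesis E4 : times_differentiable 4 E.
Implicit Types (x v : 'rV[R]_p).

Lemma loss_diff x : differentiable E x.
Proof. by case: E4. Qed.

Lemma partial_diff i x : differentiable (partial i E) x.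
Proof. by case: E4 => _ /(_ i) []. Qed.

Lemma partial2_diff i j x : differentiable (partial i (partial j E)) x.
Proof. by case: E4 => _ /(_ j) [_ /(_ i) []]. Qed.

Lemma partial2_continuous i j : continuous (partial i (partial j E)).
Proof. by move=> x; apply: differentiable_continuous; exact: partial2_diff. Qed.

Lemma partial_ball_lipschitz i : ball_lipschitz (partial i E).
Proof.
apply: ball_lipschitz_diff => [x|j]; first exact: partial_diff.
exact: partial2_continuous.
Qed.

Lemma partial2_ball_lipschitz i j : ball_lipschitz (partial i (partial j E)).
Proof.
apply: ball_lipschitz_diff => [x|k x]; first exact: partial2_diff.
apply: differentiable_continuous.
by case: E4 => _ /(_ j) [_ /(_ i) [_ /(_ k) []]].
Qed.

Lemma grad_diff x : differentiable (grad E) x.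
Proof.
have -> : grad E = fun x => \sum_i partial i E x *: delta_mx 0 i.
  by apply/funext => z; rewrite [LHS]row_sum_delta; apply: eq_bigr => i _; rewrite mxE.
have -> : (fun x => \sum_i partial i E x *: delta_mx 0 i) =
    \sum_i (fun x => partial i E x *: delta_mx 0 i : 'rV[R]_p).
  by apply/funext => z; rewrite fct_sumE.
apply: differentiable_sum => i; apply: differentiableZl.
exact: partial_diff.
Qed.

Lemma mulmx_hess v x j :
  (v *m hess E x) 0 j = \sum_i v 0 i * partial i (partial j E) x.
Proof.
rewrite -deriveEjacobian; last exact: grad_diff.
rewrite derive_mx ?mxE; last by apply: diff_derivable; exact: grad_diff.
have -> : (fun t => grad E t 0 j) = partial j E.
  by apply/funext => t; rewrite mxE.
by rewrite deriveE ?diff_partial//; exact: partial_diff.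
Qed.

Lemma grad_hessE x j :
  (grad E x *m hess E x) 0 j = \sum_i partial i E x * partial i (partial j E) x.
Proof. by rewrite mulmx_hess; apply: eq_bigr => i _; rewrite mxE. Qed.

Lemma grad_hess_ball_lipschitz j :
  ball_lipschitz (fun x => (grad E x *m hess E x) 0 j).
Proof.
under eq_fun do rewrite grad_hessE.
apply: ball_lipschitz_sum => i; apply: ball_lipschitzM.
  exact: partial_ball_lipschitz.
exact: partial2_ball_lipschitz.
Qed.

(** Differentiating the squares of the partials yields a factor 2, which turns the 4 of the modified
    loss into 2; symmetry of the Hessian then identifies the remaining sum. *)
Lemma grad_modified_loss beta h x : grad (modified_loss E beta h) x =
  grad E x + ((1 + beta) * h / (2 * (1 - beta) ^+ 2)) *: (grad E x *m hess E x).
Proof.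
apply/rowP => i; rewrite mxE [RHS]mxE [X in X + _]mxE [X in _ + X]mxE grad_hessE.
set c := (1 + beta) * h / (4 * (1 - beta) ^+ 2).
have -> : modified_loss E beta h =
    E + c *: \sum_j (partial j E * partial j E : 'rV[R]_p -> R).
  apply/funext => z; rewrite /modified_loss /norm2 sqr_sqrtr; last first.
    by apply: sumr_ge0 => j _; exact: sqr_ge0.
  rewrite [RHS]/GRing.add/= [(c *: _) z]/GRing.scale/= fct_sumE; congr (_ + c * _).
  by apply: eq_bigr => j _; rewrite mxE expr2.
have pd j : derivable (partial j E) x (delta_mx 0 i).
  by apply: diff_derivable; exact: partial_diff.
have p2d j : derivable (partial j E * partial j E) x (delta_mx 0 i).
  exact: derivableM.
have sd : derivable (\sum_j (partial j E * partial j E : 'rV[R]_p -> R)) x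
    (delta_mx 0 i) by exact: derivable_sum.
rewrite {1}/partial deriveD; last 2 first.
- by apply: diff_derivable; exact: loss_diff.
- exact: derivableZ.
rewrite deriveZ// derive_sum//; congr (_ + _).
rewrite scaler_sumr mulr_sumr; apply: eq_bigr => j _.
rewrite deriveM// (@partialC _ _ E j i); last first.
- exact: partial2_continuous.
- exact: partial_diff.
- exact: loss_diff.
rewrite -![_ *: _]/(_ * _) -/(partial i (partial j E) x) /c !invfM.
set a := partial i (partial j E) x; set b := partial j E x.
set u := (1 - beta)^-1 / _.
by field.
Qed.

End loss.

(** * Taylor estimate for scalar functions and derivatives along a trajectory *)

Section local_error.
Context {R : realType}.

(** Subtracting the quadratic with derivative c + d (t - s) leaves a function with derivative at
    most [K], to which the mean value theorem applies. The base point [s] is arbitrary, so that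
    expansions run forward and backward in time. *)
Lemma quadratic_increment (f df : R -> R) (a b s c d K : R) :
  (forall t, t \in `]a, b[ -> is_derive t 1 f (df t)) ->
  {within `[a, b], continuous f}%classic -> s \in `[a, b] ->
  (forall t, t \in `]a, b[ -> `|df t - (c + d * (t - s))| <= K) ->
  forall t, t \in `[a, b] ->
    `|f t - f s - (c * (t - s) + d * (t - s) ^+ 2 / 2)| <= K * `|t - s|.
Proof.
move=> fd fc sab dfK t tab.
pose P : {poly R} := c *: ('X - s%:P) + (d / 2) *: ('X - s%:P) ^+ 2.
pose q : R -> R := horner P.
have dq (x : R) : is_derive x 1 q (c + d * (x - s)).
  have -> : c + d * (x - s) = P^`().[x].
    rewrite /P derivD !derivZ deriv_exp derivXsubC !hornerE/=.
    by lra.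
  exact: is_derive_poly.
have qE (x : R) : q x = c * (x - s) + d * (x - s) ^+ 2 / 2.
  by rewrite /q /P !hornerE/=; lra.
pose g := f - q.
have gd (x : R) : x \in `]a, b[ -> is_derive x 1 g (df x - (c + d * (x - s))).
  by move=> xab; apply: is_deriveB; exact: fd.
have gc : {within `[a, b], continuous g}%classic.
  move=> x; apply: continuousD _; first exact: fc.
  apply/continuousN/continuous_subspaceT => z; exact: continuous_horner.
have key (u v : R) : u \in `[a, b] -> v \in `[a, b] -> u < v ->
    `|g v - g u| <= K * (v - u).
  rewrite !in_itv/= => /andP[au ub] /andP[av vb] uv.
  have uvab x : x \in `]u, v[ -> x \in `]a, b[.
    rewrite !in_itv/= => /andP[ux xv].
    by rewrite (le_lt_trans au ux) (lt_le_trans xv vb).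
  have guv : {within `[u, v], continuous g}%classic.
    apply: continuous_subspaceW gc => x /=; rewrite !in_itv/= => /andP[ux xv].
    by rewrite (le_trans au ux) (le_trans xv vb).
  have [x xuv ->] := MVT uv (fun x xuv => gd x (uvab x xuv)) guv.
  rewrite normrM (ger0_norm (x := v - u)) ?subr_ge0 ?(ltW uv)//.
  rewrite ler_wpM2r ?subr_ge0 ?(ltW uv)//; exact/dfK/uvab.
have -> : f t - f s - (c * (t - s) + d * (t - s) ^+ 2 / 2) = g t - g s.
  by rewrite /g !fctE !qE subrr; lra.
have [ts|st|->] := ltgtP t s; last by rewrite !subrr normr0 mulr0.
- rewrite distrC (le_trans (key _ _ tab sab ts))// distrC.
  by rewrite ger0_norm ?subr_ge0 ?(ltW ts).
- by rewrite (le_trans (key _ _ sab tab st))// ger0_norm ?subr_ge0 ?(ltW st).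
Qed.

Context {p : nat}.
Implicit Types (y : R -> 'rV[R]_p) (g : 'rV[R]_p -> R).

Lemma within_continuous_comp_row y g a b :
  derivable_oo_LRcontinuous y a b -> (forall x, differentiable g x) ->
  {within `[a, b], continuous (g \o y)}%classic.
Proof.
move=> /derivable_oo_LRcontinuous_within yc gd t.
apply: (@continuous_comp (subspace `[a, b]%classic) _ _ y g); first exact: yc.
exact: differentiable_continuous.
Qed.

Lemma is_derive_row_comp y g a b t : derivable_oo_LRcontinuous y a b ->
  (forall x, differentiable g x) -> t \in `]a, b[ ->
  is_derive t 1 (g \o y) (\sum_i (derive1 y t) 0 i * partial i g (y t)).
Proof.
move=> [yd _ _] gd tab; apply: is_derive_comp_row => //.
by rewrite derive1E; apply: derivableP; exact: yd.
Qed.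

Lemma is_derive_coord y a b t (j : 'I_p) :
  derivable_oo_LRcontinuous y a b -> t \in `]a, b[ ->
  is_derive t 1 (fun s => y s 0 j) ((derive1 y t) 0 j).
Proof.
move=> [yd _ _] tab; have yt := yd t tab; apply: DeriveDef.
  by move/derivable_mxP : yt; exact.
by rewrite derive1E derive_mx// mxE.
Qed.

End local_error.

(** * Second order expansion of the flow with O(h^3) remainder *)

Section flow_expansion.
Context {R : realType} {p : nat} (E : 'rV[R]_p -> R).
Hypothesis E4 : times_differentiable 4 E.

Local Notation G x := (grad E x *m hess E x).

(** The remainder is bootstrapped: a speed bound makes [y] vary by O(h), then the gradient along [y]
    is expanded up to O(h^2), then [y] itself up to O(h^3). [K] is fixed before the interval and the
    coefficients, hence uniform in step size and step index. *)
Lemma flow_expansion (T M A B : R) : 0 <= T -> 0 <= A -> 0 <= B ->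
  exists2 K, 0 <= K & forall (y : R -> 'rV[R]_p) (a b alpha gam : R),
  a <= b -> b - a <= T -> `|alpha| <= A -> `|gam| <= B ->
  derivable_oo_LRcontinuous y a b ->
  {in `[a, b], forall t, `|y t| <= M} ->
  {in `]a, b[, forall t, derive1 y t =
    - alpha *: grad E (y t) - ((b - a) * gam) *: G (y t)} ->
  {in `[a, b] &, forall s t,
    `|y t - y s + (t - s) *: (alpha *: grad E (y s) + ((b - a) * gam) *: G (y s))
      - ((t - s) ^+ 2 / 2 * alpha ^+ 2) *: G (y s)| <= K * (b - a) ^+ 3}.
Proof.
move=> T0 A0 B0.
have [BF BF0 bF] := ball_lipschitz_fin_bounded M (partial_ball_lipschitz E4).
have [BG BG0 bG] := ball_lipschitz_fin_bounded M (grad_hess_ball_lipschitz E4).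
have [LG LG0 lG] := ball_lipschitz_fin M (grad_hess_ball_lipschitz E4).
have [BH BH0 bH] := ball_lipschitz_fin_bounded M
  (fun ij : 'I_p * 'I_p => partial2_ball_lipschitz E4 ij.1 ij.2).
(* [V] bounds the speed of [y]. [K2] bounds the error in differentiating the gradient along [y]: the
   variation of G over the step, and the O(h) part of the field passed through the Hessian. *)
set V := A * BF + T * B * BG.
have V0 : 0 <= V by rewrite addr_ge0 ?mulr_ge0.
set K2 := A * (LG * V) + B * (p%:R * (BG * BH)).
have K20 : 0 <= K2 by rewrite addr_ge0 ?mulr_ge0.
exists (A * K2 + B * (LG * V)); first by rewrite addr_ge0 ?mulr_ge0.
move=> y a b alpha gam ab baT alphaA gamB yab yM ode s t sab tab.
set h := b - a in baT ode *.
have h0 : 0 <= h by rewrite subr_ge0.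
have oc u : u \in `]a, b[ -> u \in `[a, b] by exact: subset_itv_oo_cc.
have dist u v : u \in `[a, b] -> v \in `[a, b] -> `|u - v| <= h.
  rewrite !in_itv/= => /andP[? ?] /andP[? ?].
  by rewrite /h ler_norml; apply/andP; split; lra.
have odeE u j : u \in `]a, b[ -> (derive1 y u) 0 j =
    - (alpha * partial j E (y u)) - h * gam * G (y u) 0 j.
  have coordB (v w : 'rV[R]_p) c d : (c *: v - d *: w) 0 j = c * v 0 j - d * w 0 j.
    by rewrite !mxE.
  by move=> uab; rewrite ode// coordB mxE mulNr.
have hgam : `|h * gam| <= h * B by rewrite normrM (ger0_norm h0) ler_wpM2l.
have yc j : {within `[a, b], continuous (fun u => y u 0 j)}%classic.
  exact: (within_continuous_comp_row (g := fun z => z 0 j) yab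
    (fun x => differentiable_coord x 0 j)).
have yd j u : u \in `]a, b[ ->
    is_derive u 1 (fun r => y r 0 j) ((derive1 y u) 0 j).
  exact: is_derive_coord.
(* Order zero, with c = d = 0. *)
have lip u v : u \in `[a, b] -> v \in `[a, b] -> `|y u - y v| <= V * h.
  move=> uab vab; apply: norm_le_coord => [|j]; first by rewrite mulr_ge0.
  have := @quadratic_increment _ _ _ a b v 0 0 V (yd j) (yc j) vab _ u uab.
  rewrite !mul0r !addr0 subr0 !mxE => inc.
  apply: le_trans (inc _) _; last by rewrite ler_wpM2l ?dist.
  move=> r rab; rewrite mul0r addr0 subr0 odeE//.
  rewrite (le_trans (ler_normB _ _))// normrN lerD// normrM.
    by rewrite ler_pM ?bF ?yM ?oc.
  rewrite ler_pM ?bG ?yM ?oc// (le_trans hgam)//.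
  by rewrite ler_wpM2r.
have Glip u v j : u \in `[a, b] -> v \in `[a, b] ->
    `|G (y u) 0 j - G (y v) 0 j| <= LG * V * h.
  move=> uab vab; rewrite (le_trans (lG j _ _ (yM _ uab) (yM _ vab)))//.
  by rewrite -mulrA ler_wpM2l// lip.
(* Order one, with d = 0: along the flow the gradient has derivative - alpha G + O(h). *)
have Fexp u j : u \in `[a, b] ->
    `|partial j E (y u) - partial j E (y s) + (u - s) * (alpha * G (y s) 0 j)|
    <= K2 * h ^+ 2.
  move=> uab.
  have Fd r (rab : r \in `]a, b[) :=
    is_derive_row_comp yab (partial_diff E4 j) rab.
  have Fc := within_continuous_comp_row yab (partial_diff E4 j).
  have := @quadratic_increment _ _ _ a b s
    (- (alpha * G (y s) 0 j)) 0 (K2 * h) Fd Fc sab _ u uab.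
  rewrite !mul0r addr0 mulNr opprK [alpha * _ * _]mulrC => inc.
  apply: le_trans (inc _) _; last first.
    by rewrite expr2 mulrA ler_wpM2l ?dist ?mulr_ge0.
  move=> r rab; rewrite mul0r addr0 opprK.
  have -> : \sum_i (derive1 y r) 0 i * partial i (partial j E) (y r) =
      - (alpha * G (y r) 0 j)
      - h * gam * \sum_i G (y r) 0 i * partial i (partial j E) (y r).
    rewrite grad_hessE// !mulr_sumr -sumrN -sumrB; apply: eq_bigr => i _.
    by rewrite odeE//; ring.
  have alg (u1 u2 u3 c d : R) :
    - (c * u1) - d * u2 + c * u3 = c * (u3 - u1) - d * u2 by ring.
  rewrite alg (le_trans (ler_normB _ _))// /K2 [leRHS]mulrDl lerD//.
    by rewrite normrM -mulrA ler_pM// Glip// oc.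
  rewrite normrM [leRHS]mulrC [leRHS]mulrA ler_pM//.
  rewrite (le_trans (ler_norm_sum _ _ _))//.
  have -> : p%:R * (BG * BH) = \sum_(i < p) BG * BH.
    by rewrite sumr_const card_ord mulr_natl.
  apply: ler_sum => i _; rewrite normrM ler_pM ?bG ?yM ?oc//.
  by apply: (bH (i, j)); rewrite yM ?oc.
apply: norm_le_coord => [|j].
  by rewrite mulr_ge0 ?exprn_ge0// addr_ge0 ?mulr_ge0.
have := @quadratic_increment _ _ _ a b s
  (- (alpha * partial j E (y s) + h * gam * G (y s) 0 j))
  (alpha ^+ 2 * G (y s) 0 j) ((A * K2 + B * (LG * V)) * h ^+ 2)
  (yd j) (yc j) sab _ t tab.
move=> inc; apply: le_trans (le_trans (inc _) _).
- rewrite le_eqVlt; apply/orP; left; apply/eqP; congr `|_|.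
  rewrite !(mxE, grad_hessE)//; lra.
- move=> r rab; rewrite odeE//.
  have alg (f1 f2 g1 g2 c d w : R) :
    - (c * f1) - d * g1 - (- (c * f2 + d * g2) + c ^+ 2 * g2 * w) =
    - (c * (f1 - f2 + w * (c * g2))) - d * (g1 - g2) by ring.
  rewrite alg.
  rewrite (le_trans (ler_normB _ _))// normrN [leRHS]mulrDl lerD//.
    by rewrite normrM -mulrA ler_pM// Fexp// oc.
  rewrite normrM.
  by rewrite expr2 [leRHS]mulrACA ler_pM// ?[B * h]mulrC// Glip// oc.
- rewrite [h ^+ 3]exprSr [leRHS]mulrA ler_wpM2l ?dist//.
  by rewrite mulr_ge0 ?exprn_ge0// addr_ge0 ?mulr_ge0.
Qed.

End flow_expansion.

(** * Coefficients of the piecewise field *)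

Section coefficients.
Context {R : realType} (beta : R).
Hypothesis beta01 : 0 <= beta < 1.

(** The geometric sum 1 + beta + ... + beta^k. *)
Definition grad_coef k : R := (1 - beta ^+ k.+1) / (1 - beta).

Definition hess_coef k : R := gamma beta k * (1 + beta) / (2 * (1 - beta) ^+ 3).

Lemma onem_gt0 : 0 < 1 - beta.
Proof. by case/andP: beta01 => _ b1; rewrite subr_gt0. Qed.

Lemma grad_coef0 : grad_coef 0 = 1.
Proof. by rewrite /grad_coef expr1 divff// gt_eqF// onem_gt0. Qed.

Lemma grad_coefS k : grad_coef k.+1 = 1 + beta * grad_coef k.
Proof.
rewrite /grad_coef [beta ^+ k.+2]exprS; have := onem_gt0 => b1.
by field; rewrite gt_eqF.
Qed.

Lemma hess_coef0 : hess_coef 0 = 1 / 2.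
Proof.
case/andP: beta01 => b0 _; have b1 := onem_gt0.
rewrite /hess_coef /gamma muln0 add0n expr1.
by field; rewrite !gt_eqF//; lra.
Qed.

(* Matching the terms of order h^2 in the expansions of the flow forward over
   step k.+1 and backward over step k forces this recursion, which [gamma]
   solves in closed form. *)
Lemma hess_coefS k : hess_coef k.+1 =
  beta * hess_coef k + (grad_coef k.+1 ^+ 2 + beta * grad_coef k ^+ 2) / 2.
Proof.
case/andP: beta01 => b0 _; have b1 := onem_gt0.
rewrite /hess_coef /gamma /grad_coef.
rewrite ![(2 * _ + 2)%N]addnC -!mulnS !mul2n -!addnn !exprD.
rewrite [beta ^+ k.+2]exprS -[k.+2%:R]natr1; set u := beta ^+ k.+1.
by field; rewrite !gt_eqF//; lra.
Qed.

Lemma grad_coef_bound k : 0 <= grad_coef k <= (1 - beta)^-1.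
Proof.
case/andP: beta01 => b0 b1; have c0 := onem_gt0.
rewrite /grad_coef divr_ge0 ?(ltW c0) ?subr_ge0 ?exprn_ile1// ?(ltW b1)//=.
by rewrite ler_piMl ?invr_ge0 ?(ltW c0)// lerBlDr lerDl exprn_ge0.
Qed.

(** Both bounds are read off the recursion, whose terms are visibly nonnegative, rather than the
    closed form. *)
Lemma hess_coef_bound k : 0 <= hess_coef k <= (1 - beta)^-1 ^+ 3.
Proof.
case/andP: beta01 => b0 b1; have c0 := onem_gt0.
set A := (1 - beta)^-1.
have AE : beta * A + 1 = A by rewrite /A; field; rewrite gt_eqF.
have A1 : 1 <= A by rewrite /A invf_ge1//; lra.
elim: k => [|k /andP[h0 h1]].
  rewrite hess_coef0 div1r invr_ge0 ler0n/=.
  by rewrite (@le_trans _ _ 1) ?exprn_ege1// invf_le1// ler1n.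
have /andP[g0 g1] := grad_coef_bound k.
have /andP[g0' g1'] := grad_coef_bound k.+1.
have s1 : grad_coef k ^+ 2 <= A ^+ 2 by rewrite lerXn2r ?nnegrE// (le_trans _ A1).
have s2 : grad_coef k.+1 ^+ 2 <= A ^+ 2 by rewrite lerXn2r ?nnegrE// (le_trans _ A1).
have t1 : beta * grad_coef k ^+ 2 <= A ^+ 2.
  by rewrite -[leRHS]mul1r ler_pM ?sqr_ge0 ?(ltW b1).
have t2 : beta * hess_coef k <= beta * A ^+ 3 by rewrite ler_wpM2l.
have := sqr_ge0 (grad_coef k.+1); have : 0 <= beta * grad_coef k ^+ 2.
  by rewrite mulr_ge0 ?sqr_ge0.
have : 0 <= beta * hess_coef k by rewrite mulr_ge0.
(* [A ^+ 3] is the fixed point of c -> beta c + A^2, which majorizes the recursion. *)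
have AE3 : A ^+ 3 = beta * A ^+ 3 + A ^+ 2 by rewrite [A ^+ 3]exprS -{1}AE; ring.
by rewrite hess_coefS => *; apply/andP; split; lra.
Qed.

Lemma piecewise_fieldE p (E : 'rV[R]_p -> R) h k x :
  piecewise_field E beta h k x =
  - grad_coef k *: grad E x - (h * hess_coef k) *: (grad E x *m hess E x).
Proof. by rewrite /piecewise_field /hess_coef !mulrA. Qed.

End coefficients.

(** * Discrete Gronwall inequality with momentum *)

Section momentum_gronwall.
Context {R : realType} {V : normedModType R}.

Lemma expr_le_expR (x : R) n : 0 <= x -> (1 + x) ^+ n <= expR (x * n%:R).
Proof.
move=> x0; rewrite mulrC expRM_natl lerXn2r ?nnegrE ?expR_ge0 ?addr_ge0//.
exact: expR_ge1Dx.
Qed.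

(* The momentum is absorbed by estimating [e k.+1 - beta *: e k], whose
   increments are of size O(h `|e|) + O(h^3). *)
Lemma momentum_gronwall (beta L K T h : R) (n : nat) (e : nat -> V) :
  let C := K * T * expR (L / (1 - beta) * T) / (1 - beta) in
  0 <= beta < 1 -> 0 <= L -> 0 <= K -> 0 < h -> n%:R * h <= T ->
  C * h ^+ 2 <= 1 -> e 0 = 0 -> `|e 1 - beta *: e 0| <= K * h ^+ 3 ->
  (forall k, (k.+1 < n)%N -> `|e k.+1| <= 1 ->
    `|(e k.+2 - beta *: e k.+1) - (e k.+1 - beta *: e k)|
      <= h * L * `|e k.+1| + K * h ^+ 3) ->
  forall k, (k <= n)%N -> `|e k| <= C * h ^+ 2.
Proof.
move=> C /[dup] beta01 /andP[b0 b1] L0 K0 h0 nhT Ch1 e0 z0 zS.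
have c0 := onem_gt0 beta01.
set L' := L / (1 - beta).
have L'0 : 0 <= L' by rewrite divr_ge0 ?(ltW c0).
(* A supersolution of r_(k+1) = (1 + h L') r_k + K h^3. It bounds the differences
   [e k.+1 - beta *: e k] at index k + 1 and, divided by 1 - beta, the errors themselves. *)
pose B k := k%:R * (K * h ^+ 3) * (1 + h * L') ^+ k.
have Kh0 : 0 <= K * h ^+ 3 by rewrite mulr_ge0 ?exprn_ge0 ?(ltW h0).
have g1 : 1 <= 1 + h * L' by rewrite lerDl mulr_ge0 ?(ltW h0).
have BS k : B k * (1 + h * L') + K * h ^+ 3 <= B k.+1.
  have -> : B k.+1 = B k * (1 + h * L') + K * h ^+ 3 * (1 + h * L') ^+ k.+1.
    by rewrite /B -natr1 [(1 + h * L') ^+ k.+1]exprSr; ring.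
  by rewrite lerD2l ler_peMr// exprn_ege1.
have B0 k : 0 <= B k.
  apply: mulr_ge0; first exact: mulr_ge0.
  by rewrite exprn_ge0// (le_trans ler01 g1).
have Bmono k : B k <= B k.+1.
  have Bk := B0 k; apply: le_trans _ (BS k).
  have : B k <= B k * (1 + h * L') by rewrite ler_peMr.
  by move=> le1; lra.
(* The number of steps absorbs one factor h through k h <= T, and the power is at most exp(L' T). *)
have BC k : (k <= n)%N -> B k / (1 - beta) <= C * h ^+ 2.
  move=> kn; rewrite /C [leRHS]mulrAC ler_wpM2r ?invr_ge0 ?(ltW c0)//.
  have kh : k%:R * h <= T.
    by apply: le_trans _ nhT; rewrite ler_pM2r// ler_nat.
  have -> : B k = K * h ^+ 2 * (k%:R * h) * (1 + h * L') ^+ k.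
    by rewrite /B; ring.
  have -> : K * T * expR (L' * T) * h ^+ 2 = K * h ^+ 2 * T * expR (L' * T) by ring.
  have Kh2 : 0 <= K * h ^+ 2 by rewrite mulr_ge0 ?exprn_ge0 ?(ltW h0).
  rewrite ler_pM ?mulr_ge0 ?(ltW h0) ?exprn_ge0 ?(le_trans ler01 g1)//.
    by rewrite ler_wpM2l.
  have q0 : 0 <= h * L' by rewrite mulr_ge0 ?(ltW h0).
  rewrite (le_trans (expr_le_expR k q0))// ler_expR.
  by rewrite [h * L']mulrC -mulrA ler_wpM2l// mulrC.
have eB k : `|e k.+1 - beta *: e k| <= B k.+1 -> `|e k| <= B k / (1 - beta) ->
    `|e k.+1| <= B k.+1 / (1 - beta).
  move=> zk ek; rewrite -[e k.+1](subrK (beta *: e k)) (le_trans (ler_normD _ _))//.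
  have -> : B k.+1 / (1 - beta) = B k.+1 + beta * (B k.+1 / (1 - beta)).
    by field; rewrite gt_eqF.
  rewrite lerD// normrZ (ger0_norm b0) ler_wpM2l// (le_trans ek)//.
  by rewrite ler_wpM2r ?invr_ge0 ?(ltW c0).
have inv k : (k < n)%N ->
    `|e k| <= B k / (1 - beta) /\ `|e k.+1 - beta *: e k| <= B k.+1.
  elim: k => [|k IH] kn.
    rewrite e0 normr0 divr_ge0 ?(ltW c0)//; split=> //; move: z0.
    rewrite e0 => /le_trans; apply; rewrite /B mul1r expr1.
    by rewrite ler_peMr.
  have [ek zk] := IH (ltnW kn).
  have ek1 := eB k zk ek; split=> //.
  (* The local hypothesis [zS] is available only for errors at most 1; the bound just obtained
     guarantees this. *)
  have ek1' : `|e k.+1| <= 1 := le_trans ek1 (le_trans (BC _ (ltnW kn)) Ch1).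
  have zk1 := zS k kn ek1'.
  have tri := ler_normD (e k.+1 - beta *: e k)
    ((e k.+2 - beta *: e k.+1) - (e k.+1 - beta *: e k)).
  rewrite [X in `|X|]addrC subrK in tri.
  have hL : h * L * `|e k.+1| <= B k.+1 * (h * L').
    have -> : B k.+1 * (h * L') = h * L * (B k.+1 / (1 - beta)) by rewrite /L'; ring.
    by rewrite ler_wpM2l// mulr_ge0 ?(ltW h0).
  apply: le_trans tri _; apply: le_trans _ (BS k.+1); move: zk zk1 hL.
  move: (`|_|) (`|_|) (`|_|) (B k.+1) => r1 r2 r3 r4 *; lra.
case=> [|k] kn.
  by rewrite e0 normr0 (le_trans _ (BC 0 isT))// divr_ge0 ?(ltW c0).
have [ek zk] := inv k kn.
exact: le_trans (eB k zk ek) (BC _ kn).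
Qed.

End momentum_gronwall.

(** * Convergence for uniformly bounded trajectories *)

Section bounded_case.
Context {R : realType} {p : nat} (E : 'rV[R]_p -> R) (beta T : R).
Context (x0 : 'rV[R]_p).
Hypotheses (E4 : times_differentiable 4 E) (beta01 : 0 <= beta < 1) (T0 : 0 < T).

Local Notation G x := (grad E x *m hess E x).
Local Notation hb h := (heavy_ball E beta x0 h).

Lemma grad_lipschitz M : exists2 L, 0 <= L & forall x y : 'rV[R]_p,
  `|x| <= M -> `|y| <= M -> `|grad E x - grad E y| <= L * `|x - y|.
Proof.
have [L L0 lF] := ball_lipschitz_fin M (partial_ball_lipschitz E4).
exists L => // x y xM yM; apply: norm_le_coord => [|i]; first exact: mulr_ge0.
by rewrite !mxE lF.
Qed.

Lemma grad_bounded M : exists2 B, 0 <= B & forall x : 'rV[R]_p,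
  `|x| <= M -> `|grad E x| <= B.
Proof.
have [B B0 bF] := ball_lipschitz_fin_bounded M (partial_ball_lipschitz E4).
by exists B => // x xM; apply: norm_le_coord => // i; rewrite mxE bF.
Qed.

Lemma heavy_ballS h k : hb h k.+2 =
  hb h k.+1 - h *: grad E (hb h k.+1) + beta *: (hb h k.+1 - hb h k).
Proof. by []. Qed.

Lemma heavy_ball1 h : hb h 1 = x0 - h *: grad E x0.
Proof. by rewrite /= subrr scaler0 addr0. Qed.

(** Serves the large step sizes, for which the number of steps is bounded; the bound may grow with
    [N] but is uniform in [h]. *)
Lemma heavy_ball_bounded N : exists2 M, 0 <= M & forall h k,
  0 < h < T -> (k <= N)%N -> `|hb h k| <= M.
Proof.
case/andP: beta01 => b0 b1.
elim: N => [|N [M M0 IH]].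
  by exists `|x0| => // h k _; rewrite leqn0 => /eqP ->.
have [B B0 bB] := grad_bounded M.
(* One [M] for the current iterate, two for the momentum difference, and [T * B] for the gradient
   step. *)
exists (3 * M + T * B) => [|h k hT].
  by rewrite addr_ge0 ?mulr_ge0 ?(ltW T0).
have TB0 : 0 <= T * B by rewrite mulr_ge0 ?(ltW T0).
rewrite leq_eqVlt => /predU1P[->{k}|]; last first.
  by rewrite ltnS => /(IH h k hT) kM; lra.
have /andP[h0 hltT] := hT.
have gb k : (k <= N)%N -> `|h *: grad E (hb h k)| <= T * B.
  move=> kN; rewrite normrZ (gtr0_norm h0) ler_pM ?(ltW h0) ?(ltW hltT)//.
  exact/bB/IH.
case: N IH gb => [|N] IH gb.
  rewrite heavy_ball1 (le_trans (ler_normB _ _))// lerD//; last exact: (gb 0).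
  by have := IH h 0 hT isT; rewrite /= => xM; lra.
rewrite heavy_ballS (le_trans (ler_normD _ _))//.
have xM := IH h N.+1 hT (leqnn _); have xM' := IH h N hT (leqnSn _).
have s1 := le_trans (ler_normB _ _) (lerD xM (gb N.+1 (leqnn _))).
have s2 : `|beta *: (hb h N.+1 - hb h N)| <= 1 * (M + M).
  rewrite normrZ (ger0_norm b0) ler_pM ?(ltW b1)//.
  exact: le_trans (ler_normB _ _) (lerD xM xM').
by apply: le_trans (lerD s1 s2) _; lra.
Qed.

Lemma timeS (h : R) k : time h k.+1 - time h k = h.
Proof. by rewrite /time -natr1; ring. Qed.

Lemma nsteps_time (h : R) k : 0 < h -> (k <= nsteps T h)%N -> time h k <= T.
Proof.
move=> h0 kn; rewrite /time -ler_pdivlMr//.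
by rewrite -truncn_ge_nat// divr_ge0 ?ltW.
Qed.

Lemma time_le (h : R) k l : 0 < h -> (k <= l)%N -> time h k <= time h l.
Proof. by move=> h0 kl; rewrite /time ler_pM2r// ler_nat. Qed.

(* The forward expansion over one step plus [beta] times the backward
   expansion over the previous one is the defect of the trajectory in the
   heavy-ball recursion: all other terms cancel. *)
Lemma consistency M : exists2 K, 0 <= K & forall h xt, 0 < h < T ->
  piecewise_trajectory E beta T x0 h xt ->
  (forall t, 0 <= t <= time h (nsteps T h) -> `|xt t| <= M) ->
  ((0 < nsteps T h)%N ->
    `|xt (time h 1) - xt 0 + h *: grad E (xt 0)| <= K * h ^+ 3) /\
  forall k, (k.+1 < nsteps T h)%N ->
    `|xt (time h k.+2) - xt (time h k.+1) + h *: grad E (xt (time h k.+1))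
      - beta *: (xt (time h k.+1) - xt (time h k))| <= K * h ^+ 3.
Proof.
case/andP: (beta01) => b0 b1.
set A := (1 - beta)^-1.
have A0 : 0 <= A by rewrite invr_ge0 subr_ge0 ltW.
have [K K0 exp] := flow_expansion E4 M (ltW T0) A0 (exprn_ge0 3 A0).
(* One [K] from the forward expansion, and beta < 1 times another from the backward one. *)
exists (2 * K) => [|h xt hT [xt0 ode] xtM]; first by rewrite mulr_ge0.
have /andP[h0 hltT] := hT.
have {}exp k s t : (k < nsteps T h)%N ->
    s \in `[time h k, time h k.+1] -> t \in `[time h k, time h k.+1] ->
    `|xt t - xt s + (t - s) *: (grad_coef beta k *: grad E (xt s)
        + (h * hess_coef beta k) *: G (xt s))
      - ((t - s) ^+ 2 / 2 * grad_coef beta k ^+ 2) *: G (xt s)| <= K * h ^+ 3.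
  move=> kn sk tk; have [oc odek] := ode k kn.
  have /andP[g0 g1] := grad_coef_bound beta01 k.
  have /andP[c0 c1] := hess_coef_bound beta01 k.
  have := exp xt (time h k) (time h k.+1) (grad_coef beta k) (hess_coef beta k).
  rewrite timeS; apply=> //.
  - by rewrite time_le.
  - exact: ltW.
  - by rewrite ger0_norm.
  - by rewrite ger0_norm.
  - move=> u; rewrite in_itv/= => /andP[u0 u1]; apply: xtM.
    rewrite (le_trans _ u0)/= ?mulr_ge0 ?(ltW h0)//.
    by rewrite (le_trans u1)// time_le.
  - by move=> u uk; rewrite odek// piecewise_fieldE.
have tl k : time h k \in `[time h k, time h k.+1].
  by rewrite in_itv/= lexx time_le.
have tr k : time h k.+1 \in `[time h k, time h k.+1].
  by rewrite in_itv/= lexx time_le.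
have Kh : 0 <= K * h ^+ 3 by rewrite mulr_ge0 ?exprn_ge0 ?(ltW h0).
split=> [n0|k kn].
  have := exp 0 (time h 0) (time h 1) n0 (tl 0) (tr 0).
  have t0 : time h 0 = 0 by rewrite /time mul0r.
  (* With initial coefficients 1 and 1/2 the terms in h^2 cancel, leaving a plain gradient step. *)
  rewrite timeS (grad_coef0 beta01) (hess_coef0 beta01) t0.
  move: (xt 0) (xt _) => x x1.
  have -> : x1 - x + h *: (1 *: grad E x + (h * (1 / 2)) *: G x) -
      (h ^+ 2 / 2 * 1 ^+ 2) *: G x = x1 - x + h *: grad E x.
    by apply/rowP => i; rewrite !mxE; field.
  by move=> /le_trans; apply; lra.
have := exp k.+1 (time h k.+1) (time h k.+2) kn (tl _) (tr _).
have := exp k (time h k.+1) (time h k) (ltnW kn) (tr _) (tl _).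
have -> : time h k - time h k.+1 = - h by rewrite -opprB timeS.
rewrite timeS (grad_coefS beta01) (hess_coefS beta01) (grad_coefS beta01).
move: (grad_coef beta k) (hess_coef beta k) => a c.
move: (xt (time h k)) (xt (time h k.+1)) (xt (time h k.+2)) => y0 y1 y2.
set bwd := (X in `|X| <= _ -> _); set fwd := (X in _ -> `|X| <= _ -> _).
move=> bK fK.
have -> : y2 - y1 + h *: grad E y1 - beta *: (y1 - y0) = fwd + beta *: bwd.
  rewrite /fwd /bwd; move: (grad E y1) (G y1) => f g.
  by apply/rowP => i; rewrite !mxE; field.
rewrite (le_trans (ler_normD _ _))// normrZ (ger0_norm b0).
have : beta * `|bwd| <= 1 * (K * h ^+ 3) by rewrite ler_pM ?(ltW b1).
by lra.
Qed.

(** Two regimes meet at C h^2 = 1: below it Gronwall applies; above it trajectory and iterates are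
    merely bounded, and any constant is at most that constant times C h^2. *)
Lemma bounded_close xt :
  (forall h, 0 < h < T -> piecewise_trajectory E beta T x0 h (xt h)) ->
  uniformly_bounded T xt -> bigO_close 2 T (heavy_ball E beta x0) xt.
Proof.
move=> ode [M' xtM'].
case/andP: (beta01) => b0 b1.
set M := `|M'|.
have xtM h t : 0 < h < T -> 0 <= t <= time h (nsteps T h) -> `|xt h t| <= M.
  move=> hT tn; rewrite (le_trans (norm_le_norm2 _))// (le_trans (xtM' h t hT tn))//.
  exact: ler_norm.
have [K K0 cons] := consistency M.
(* While C h^2 <= 1 the iterates stay within distance 1 of the trajectory, hence the radius
   [M + 1]. *)
have [L L0 lip] := grad_lipschitz (M + 1).
set C := K * T * expR (L / (1 - beta) * T) / (1 - beta).
have C0 : 0 <= C.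
  by rewrite divr_ge0 ?subr_ge0 ?(ltW b1)// !mulr_ge0 ?expR_ge0// ltW.
(* If C h^2 > 1, then k <= k^2 <= k^2 C h^2 = C t_k^2 <= C T^2 bounds the number of steps. *)
have [D D0 hbD] := heavy_ball_bounded (Num.truncn (T ^+ 2 * C)).+1.
suff main h k : 0 < h < T -> (k <= nsteps T h)%N ->
    `|xt h (time h k) - hb h k| <= (C + (M + D) * C) * h ^+ 2.
  exists (p%:R * (C + (M + D) * C)) => h hT k /andP[_ kn].
  by rewrite (le_trans (norm2_le_norm _))// -mulrA ler_wpM2l// main.
move=> hT kn; have /andP[h0 hltT] := hT.
have h20 : 0 <= h ^+ 2 by exact: sqr_ge0.
have tin l : (l <= nsteps T h)%N -> 0 <= time h l <= time h (nsteps T h).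
  by move=> ln; rewrite time_le// mulr_ge0 ?(ltW h0).
have MD0 : 0 <= (M + D) * C by rewrite mulr_ge0 ?addr_ge0 ?normr_ge0.
have [Ch1|Ch1] := leP (C * h ^+ 2) 1; last first.
  have kN : (k <= (Num.truncn (T ^+ 2 * C)).+1)%N.
    have TC0 : 0 <= T ^+ 2 * C := mulr_ge0 (sqr_ge0 T) C0.
    apply: leqW; rewrite truncn_ge_nat//.
    case: k kn => [//|k] kn.
    have kT := nsteps_time h0 kn.
    have k1 : (1 : R) <= k.+1%:R by rewrite ler1n.
    have k2 : k.+1%:R <= k.+1%:R ^+ 2 * (C * h ^+ 2) :> R.
      rewrite -[leLHS]mulr1 ler_pM ?(ltW Ch1)//.
      by rewrite expr2 ler_peMr.
    rewrite (le_trans k2)//.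
    have -> : k.+1%:R ^+ 2 * (C * h ^+ 2) = time h k.+1 ^+ 2 * C.
      by rewrite /time; ring.
    rewrite ler_wpM2r// lerXn2r ?nnegrE ?(ltW T0)//.
    by rewrite mulr_ge0 ?(ltW h0).
  rewrite (le_trans (ler_normB _ _))//.
  have := xtM h _ hT (tin k kn); have := hbD h k hT kN => u1 u2.
  apply: (@le_trans _ _ ((M + D) * 1)); first by rewrite mulr1 lerD.
  rewrite [leRHS]mulrDl -[leLHS]add0r lerD//; first exact: mulr_ge0.
  by rewrite -mulrA ler_wpM2l ?addr_ge0 ?normr_ge0// ltW.
apply: (@le_trans _ _ (C * h ^+ 2)); last by rewrite ler_wpM2r// lerDl.
have [cons0 consS] := cons h (xt h) hT (ode h hT) (fun t => xtM h t hT).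
have xt0 : xt h 0 = x0 by case: (ode h hT).
have t0 : time h 0 = 0 by rewrite /time mul0r.
case: k kn => [|k] kn.
  by rewrite t0 xt0 subrr normr0 mulr_ge0.
pose e l := xt h (time h l) - hb h l.
apply: (@momentum_gronwall _ _ beta L K T h (nsteps T h) e) => //.
- exact: nsteps_time.
- by rewrite /e t0 xt0 subrr.
- have e0 : e 0 = 0 by rewrite /e t0 xt0 subrr.
  rewrite e0 scaler0 subr0 /e heavy_ball1 -xt0 opprB addrC.
  have := cons0 (leq_ltn_trans (leq0n k) kn).
  by rewrite -[xt h (time h 1) - _ + _]addrA [- xt h 0 + _]addrC addrC.
- move=> l ln el1.
  have -> : e l.+2 - beta *: e l.+1 - (e l.+1 - beta *: e l) =
      (xt h (time h l.+2) - xt h (time h l.+1) + h *: grad E (xt h (time h l.+1))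
        - beta *: (xt h (time h l.+1) - xt h (time h l)))
      - h *: (grad E (xt h (time h l.+1)) - grad E (hb h l.+1)).
    rewrite /e heavy_ballS.
    by apply/rowP => i; rewrite !mxE; ring.
  rewrite (le_trans (ler_normB _ _))// addrC lerD//; last exact: consS.
  have xM := xtM h _ hT (tin l.+1 (ltnW ln)).
  rewrite normrZ (gtr0_norm h0) -mulrA ler_wpM2l ?(ltW h0)// lip//.
    by rewrite (le_trans xM)// lerDl.
  have -> : hb h l.+1 = xt h (time h l.+1) - e l.+1 by rewrite /e opprB addrC subrK.
  by rewrite (le_trans (ler_normB _ _))// lerD.
Qed.

End bounded_case.

(** * A priori bound on trajectories under a Lipschitz gradient *)

Section lipschitz_case.
Context {R : realType} {p : nat} (E : 'rV[R]_p -> R) (beta T : R).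
Context (x0 : 'rV[R]_p).
Hypotheses (E4 : times_differentiable 4 E) (beta01 : 0 <= beta < 1) (T0 : 0 < T).

Local Notation G x := (grad E x *m hess E x).

(** The Lipschitz condition bounds the difference quotients of the gradient, and the bound passes to
    the limit. *)
Lemma lipschitz_partial2_bound (L : R) :
  (forall x y, norm2 (grad E x - grad E y) <= L * norm2 (x - y)) ->
  forall i j x, `|partial i (partial j E) x| <= `|L| * norm2 ('e_i : 'rV[R]_p).
Proof.
move=> lip i j x; rewrite /partial.
have /cvg_ex[l ql] := diff_derivable (v := 'e_i) (partial_diff E4 j x).
rewrite /derive (cvg_lim _ ql)//.
apply: (cvgr_to_le (cvg_norm ql)).
near=> s.
have s0 : s != 0 by near: s; exact: nbhs_dnbhs_neq.
rewrite /= normrZ normfV ler_pdivrMl ?normr_gt0//.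
have := lip (s *: 'e_i + x) x; rewrite addrK => le1.
have -> : partial j E (s *: 'e_i + x) - partial j E x =
    (grad E (s *: 'e_i + x) - grad E x) 0 j by rewrite !mxE.
rewrite (le_trans (coord_le_norm _ _))// (le_trans (norm_le_norm2 _))//.
have -> : `|s| * (`|L| * norm2 ('e_i : 'rV[R]_p)) = `|L| * norm2 (s *: 'e_i : 'rV[R]_p).
  rewrite [RHS]mulrC mulrCA mulrC; congr (_ * _).
  rewrite /norm2 -sqrtr_sqr -sqrtrM ?sqr_ge0// mulr_sumr; congr Num.sqrt.
  by apply: eq_bigr => k _; rewrite [in RHS]mxE exprMn.
by rewrite (le_trans le1)// ler_wpM2r ?norm2_ge0// ler_norm.
Unshelve. all: by end_near. Qed.

Lemma lipschitz_grad_bound : lipschitz_smooth E ->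
  exists2 C, 0 <= C & forall x, `|grad E x| <= C * (1 + `|x|).
Proof.
move=> [L lip]; exists (`|grad E 0| + `|L| * p%:R) => [|x].
  by rewrite addr_ge0 ?mulr_ge0.
rewrite -[grad E x](subrK (grad E 0)) (le_trans (ler_normD _ _))//.
have : `|grad E x - grad E 0| <= `|L| * p%:R * `|x|.
  rewrite (le_trans (norm_le_norm2 _))// (le_trans (lip x 0))// subr0.
  rewrite (@le_trans _ _ (`|L| * norm2 x)) ?ler_wpM2r ?norm2_ge0 ?ler_norm//.
  by rewrite -mulrA ler_wpM2l// norm2_le_norm.
have : 0 <= `|L| * p%:R by rewrite mulr_ge0.
have : 0 <= `|grad E 0| * `|x| by rewrite mulr_ge0.
move: (`|grad E 0|) (`|_ - _|) (`|x|) (`|L| * _) => a b c d ? ? ?; nra.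
Qed.

(** G is a gradient of linear growth times a bounded Hessian, and the coefficients are bounded
    uniformly in [h] and [k]. Linear growth of the field excludes blow-up. *)
Lemma lipschitz_field_bound : lipschitz_smooth E ->
  exists2 C, 0 <= C & forall h k x, 0 < h < T ->
    `|piecewise_field E beta h k x| <= C * (1 + `|x|).
Proof.
move=> lipE; have [CF CF0 bF] := lipschitz_grad_bound lipE.
have [L /lipschitz_partial2_bound bH] := lipE.
set S := \sum_(i < p) `|L| * norm2 ('e_i : 'rV[R]_p).
have S0 : 0 <= S by apply: sumr_ge0 => i _; rewrite mulr_ge0 ?norm2_ge0.
have bG x : `|G x| <= CF * S * (1 + `|x|).
  apply: norm_le_coord => [|j]; first by rewrite !mulr_ge0 ?addr_ge0.
  rewrite grad_hessE// (le_trans (ler_norm_sum _ _ _))// /S mulrAC mulr_sumr.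
  apply: ler_sum => i _; rewrite normrM ler_pM// (le_trans _ (bF x))//.
  by have := coord_le_norm (grad E x) i; rewrite mxE.
set A := (1 - beta)^-1.
have A0 : 0 <= A by rewrite invr_ge0 ltW// onem_gt0.
have TA0 : 0 <= T * A ^+ 3 by rewrite mulr_ge0 ?exprn_ge0 ?(ltW T0).
exists (A * CF + T * A ^+ 3 * (CF * S)) => [|h k x /andP[h0 hT]].
  exact: addr_ge0 (mulr_ge0 A0 CF0) (mulr_ge0 TA0 (mulr_ge0 CF0 S0)).
have /andP[a0 a1] := grad_coef_bound beta01 k.
have /andP[c0 c1] := hess_coef_bound beta01 k.
rewrite piecewise_fieldE (le_trans (ler_normB _ _))// mulrDl lerD//.
  by rewrite normrZ normrN ger0_norm// -[leRHS]mulrA ler_pM ?bF.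
rewrite normrZ (ger0_norm (mulr_ge0 (ltW h0) c0)) -[leRHS]mulrA ler_pM ?bG//.
  exact: mulr_ge0 (ltW h0) c0.
by rewrite ler_pM ?(ltW h0) ?(ltW hT).
Qed.

Definition sqnorm (x : 'rV[R]_p) : R := \sum_i x 0 i * x 0 i.

Lemma sqnormE x : sqnorm x = norm2 x ^+ 2.
Proof.
rewrite /norm2 sqr_sqrtr; last by apply: sumr_ge0 => i _; exact: sqr_ge0.
by apply: eq_bigr => i _; rewrite expr2.
Qed.

Lemma derive_coord (x v : 'rV[R]_p) i : 'D_v (fun z : 'rV[R]_p => z 0 i) x = v 0 i.
Proof.
have := derive_mx (@derivable_id _ 'rV[R]_p x v).
by rewrite derive_id => /rowP/(_ i) ->; rewrite mxE.
Qed.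

Lemma sqnorm_fun : sqnorm =
  \sum_i ((fun z : 'rV[R]_p => z 0 i) * (fun z : 'rV[R]_p => z 0 i) : 'rV[R]_p -> R).
Proof. by apply/funext => x; rewrite fct_sumE. Qed.

Lemma sqnorm_diff x : differentiable sqnorm x.
Proof.
rewrite sqnorm_fun; apply: differentiable_sum => i.
by apply: differentiableM; exact: differentiable_coord.
Qed.

Lemma diff_sqnorm x v : 'd sqnorm x v = \sum_i 2 * x 0 i * v 0 i.
Proof.
have cd i : derivable (fun z : 'rV[R]_p => z 0 i) x v.
  by apply: diff_derivable; exact: differentiable_coord.
rewrite -deriveE; last exact: sqnorm_diff.
rewrite sqnorm_fun derive_sum => [|i]; last exact: derivableM.
apply: eq_bigr => i _; rewrite deriveM// derive_coord -![_ *: _]/(_ * _); ring.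
Qed.

(** Gronwall in differential form: the energy 1 + |y|^2 grows at rate at most 4 p C, so its product
    with the decaying exponential has nonpositive derivative. *)
Lemma energy_decay (C a b : R) (y : R -> 'rV[R]_p) : 0 <= C ->
  derivable_oo_LRcontinuous y a b ->
  {in `]a, b[, forall t, `|derive1 y t| <= C * (1 + `|y t|)} ->
  forall t, t \in `[a, b] ->
  (1 + sqnorm (y t)) * expR (- (4 * p%:R * C * t)) <=
  (1 + sqnorm (y a)) * expR (- (4 * p%:R * C * a)).
Proof.
move=> C0 yab dy t tab; set kap := 4 * p%:R * C.
pose ex (s : R) := expR (- (kap * s)).
pose w := (cst 1 + (sqnorm \o y)) * ex.
have exd (s : R) : is_derive s 1 ex (- kap * ex s).
  have kd : is_derive s 1 ( *%R (- kap)) (- kap).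
    by apply: DeriveDef; [exact: derivableZ|
      rewrite deriveZ// derive_id /GRing.scale/= mulr1].
  have -> : ex = expR \o *%R (- kap) by apply/funext => r; rewrite /ex/= mulNr.
  have := @is_derive1_comp _ expR ( *%R (- kap)) s _ _ (is_derive_expR _) kd.
  by rewrite mulrC.
pose dN s := \sum_i (2 * y s 0 i * derive1 y s 0 i).
have wd s : s \in `]a, b[ ->
    is_derive s 1 w ((dN s - kap * (1 + sqnorm (y s))) * ex s).
  move=> sab.
  have Nd := is_derive_row_comp yab sqnorm_diff sab.
  rewrite -diff_partial ?diff_sqnorm in Nd; last exact: sqnorm_diff.
  have cd : is_derive s (1 : R) (cst (1 : R) : R -> R) 0 by exact: is_derive_cst.
  have := is_deriveM (is_deriveD cd Nd) (exd s).
  rewrite add0r -![_ *: _]/(_ * _) => wds.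
  by apply: is_derive_eq wds _; rewrite /dN fctE/=; ring.
have wc : {within `[a, b], continuous w}%classic.
  move=> s; apply: continuousM.
    apply: continuousD; first exact: cst_continuous.
    exact: (within_continuous_comp_row yab sqnorm_diff).
  apply: continuous_subspaceT => {}s.
  by apply: differentiable_continuous; apply/derivable1_diffP; case: (exd s).
have ab : a <= b by move: tab; rewrite in_itv/= => /andP[]; exact: le_trans.
have dw s : s \in `]a, b[ -> derivable w s 1 by move=> /wd [].
have w0 s : s \in `]a, b[ -> derive1 w s <= 0.
  move=> sab; rewrite derive1E; have [_ ->] := wd s sab.
  rewrite mulr_le0_ge0 ?expR_ge0// subr_le0 /dN.
  have ys := norm_le_norm2 (y s); have y0 := normr_ge0 (y s).
  have sq : `|y s| ^+ 2 <= sqnorm (y s).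
    by rewrite sqnormE lerXn2r ?nnegrE ?norm2_ge0.
  (* The rate is split evenly over the p coordinates, each contributing at most 2 C |y| (1 + |y|) <=
     4 C (1 + |y|^2) in the sup norm on the left and the Euclidean norm on the right. *)
  have -> : kap * (1 + sqnorm (y s)) = \sum_(i < p) 4 * C * (1 + sqnorm (y s)).
    by rewrite sumr_const card_ord -mulr_natl /kap; ring.
  apply: ler_sum => i _.
  have yi := coord_le_norm (y s) i; have dyi := coord_le_norm (derive1 y s) i.
  rewrite (le_trans (ler_norm _))// -mulrA !normrM ger0_norm//.
  have m1 : `|y s 0 i| * `|derive1 y s 0 i| <= `|y s| * (C * (1 + `|y s|)).
    by rewrite ler_pM// (le_trans dyi)// dy.
  have m2 : `|y s| * (1 + `|y s|) <= 2 * (1 + sqnorm (y s)).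
    by move: (`|y s|) (sqnorm _) y0 sq => u v ? ?; nra.
  have m3 := ler_wpM2l C0 m2.
  by rewrite (le_trans (ler_wpM2l _ m1))//; lra.
have := ler0_derive1_le_cc dw w0 wc.
move=> /(_ t a tab); rewrite in_itv/= lexx ab => /(_ isT).
by move: tab; rewrite in_itv/= => /andP[at_ _] /(_ at_).
Qed.

Lemma lipschitz_bounded xt : lipschitz_smooth E ->
  (forall h, 0 < h < T -> piecewise_trajectory E beta T x0 h (xt h)) ->
  uniformly_bounded T xt.
Proof.
move=> /lipschitz_field_bound[C C0 bC] ode.
set kap := 4 * p%:R * C.
have kap0 : 0 <= kap by rewrite !mulr_ge0.
have q0 : 0 <= 1 + sqnorm x0 by rewrite addr_ge0// sqnormE sqr_ge0.
exists (Num.sqrt ((1 + sqnorm x0) * expR (kap * T))) => h t hT tn.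
have /andP[h0 _] := hT; have [xt0 odeh] := ode h hT.
(* The field jumps at grid points, so the energy estimate is chained interval by interval through
   the common endpoint values. *)
have decay k : (k <= nsteps T h)%N -> forall t, t \in `[0, time h k] ->
    (1 + sqnorm (xt h t)) * expR (- (kap * t)) <= 1 + sqnorm x0.
  elim: k => [|k IH] kn s; rewrite in_itv/= => /andP[s0].
    rewrite /time mul0r => s0'; have -> : s = 0 by apply/le_anti; rewrite s0 s0'.
    by rewrite xt0 mulr0 oppr0 expR0 mulr1.
  have tk0 : 0 <= time h k by rewrite mulr_ge0 ?(ltW h0).
  have [sk _|sk sk1] := leP s (time h k).
    by apply: IH (ltnW kn) _ _; rewrite in_itv/= s0.
  have [oc odek] := odeh k kn.
  apply: le_trans (energy_decay C0 oc _ _) (IH (ltnW kn) (time h k) _).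
  - by move=> u uk; rewrite odek// bC.
  - by rewrite in_itv/= (ltW sk).
  - by rewrite in_itv/= tk0 lexx.
have tT : t <= T.
  by case/andP: tn => _ /le_trans; apply; exact: nsteps_time.
have := decay _ (leqnn _) t; rewrite in_itv/= => /(_ tn) dec.
rewrite /norm2 ler_wsqrtr//.
have -> : \sum_i xt h t 0 i ^+ 2 = sqnorm (xt h t).
  by apply: eq_bigr => i _; rewrite expr2.
apply: (@le_trans _ _ (1 + sqnorm (xt h t))); first by rewrite lerDr.
have eT : expR (kap * t) <= expR (kap * T) by rewrite ler_expR ler_wpM2l.
have -> : 1 + sqnorm (xt h t) =
    (1 + sqnorm (xt h t)) * expR (- (kap * t)) * expR (kap * t).
  by rewrite -mulrA -expRD addNr expR0 mulr1.
apply: le_trans (ler_wpM2r (expR_ge0 _) dec) _.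
by rewrite ler_wpM2l.
Qed.

End lipschitz_case.

(** * Convergence of the piecewise field to the reduced field *)

Section reduction.
Context {R : realType}.

(** The induction runs on n r^n (1 - r) + r^n <= 1, whose left side is nonincreasing in n. *)
Lemma natmul_expr_le (r : R) n : 0 <= r < 1 -> n%:R * r ^+ n <= (1 - r)^-1.
Proof.
move=> /andP[r0 r1]; have s0 : 0 < 1 - r by rewrite subr_gt0.
rewrite -[leRHS]mul1r ler_pdivlMr//.
suff : n%:R * r ^+ n * (1 - r) + r ^+ n <= 1.
  by have := exprn_ge0 n r0 => *; lra.
elim: n => [|n IH]; first by rewrite mul0r mul0r add0r.
apply: le_trans IH; rewrite exprS -natr1.
have n0 : 0 <= n%:R :> R by [].
have u0 := exprn_ge0 n r0.
rewrite -subr_ge0; set u := r ^+ n in u0 *; set m := n%:R in n0 *.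
have -> : m * u * (1 - r) + u - ((m + 1) * (r * u) * (1 - r) + r * u) =
  u * ((1 - r) ^+ 2 * (m + 1)) by ring.
by rewrite mulr_ge0// mulr_ge0 ?sqr_ge0 ?addr_ge0.
Qed.

(** With r the square root of b, n b^n = (n r^n) r^n is a bounded factor times one tending to 0. *)
Lemma cvg_natmul_expr (b : R) : 0 <= b < 1 ->
  (n%:R * b ^+ n @[n --> \oo] --> 0)%classic.
Proof.
move=> /andP[b0 b1]; set r := Num.sqrt b.
have r0 : 0 <= r := sqrtr_ge0 b.
have r1 : r < 1 by rewrite -sqrtr1 ltr_sqrt.
have bE : b = r ^+ 2 by rewrite sqr_sqrtr.
have rn : ((1 - r)^-1 * r ^+ n @[n --> \oo] --> 0)%classic.
  rewrite -[X in (_ --> X)%classic](mulr0 (1 - r)^-1).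
  by apply: cvgMr; apply: cvg_expr; rewrite ger0_norm.
apply: (squeeze_cvgr _ (cvg_cst 0) rn); apply: nearW => n.
rewrite mulr_ge0 ?exprn_ge0//= bE -exprM mul2n -addnn exprD mulrA.
by rewrite ler_wpM2r ?exprn_ge0// natmul_expr_le// r0.
Qed.

Context {p : nat} (E : 'rV[R]_p -> R) (beta T : R).
Hypotheses (E4 : times_differentiable 4 E) (beta01 : 0 <= beta < 1) (T0 : 0 < T).

Local Notation G x := (grad E x *m hess E x).

Definition hess_coef_lim : R := (1 + beta) / (2 * (1 - beta) ^+ 3).

Lemma hess_coef_lim_ge0 : 0 <= hess_coef_lim.
Proof.
case/andP: beta01 => b0 _; have c0 := onem_gt0 beta01.
by rewrite divr_ge0 ?addr_ge0// mulr_ge0// exprn_ge0// ltW.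
Qed.

Lemma reduced_fieldE h x : reduced_field E beta h x =
  - (1 - beta)^-1 *: grad E x - (h * hess_coef_lim) *: G x.
Proof.
have c0 := onem_gt0 beta01.
rewrite /reduced_field grad_modified_loss// /hess_coef_lim.
move: (grad E x) (G x) => f g; apply/rowP => i; rewrite !mxE; field.
by rewrite gt_eqF.
Qed.

(** The factor k + 1 is a deliberate loss: both coefficient errors then share the majorant (k + 1)
    beta^(k + 1). *)
Lemma grad_coef_lim k :
  `|(1 - beta)^-1 - grad_coef beta k| <= (1 - beta)^-1 * (k.+1%:R * beta ^+ k.+1).
Proof.
case/andP: beta01 => b0 _; have c0 := onem_gt0 beta01.
have -> : (1 - beta)^-1 - grad_coef beta k = (1 - beta)^-1 * beta ^+ k.+1.
  by rewrite /grad_coef; field; rewrite gt_eqF.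
have i0 : 0 <= (1 - beta)^-1 by rewrite invr_ge0 ltW.
have u0 := exprn_ge0 k.+1 b0.
rewrite ger0_norm ?mulr_ge0// ler_wpM2l// ler_peMl//.
by rewrite ler1n.
Qed.

(** Of the 5, one unit absorbs beta^(2k + 2) and four come from the linear term of [gamma], since (1
    - beta) / (1 + beta) <= 1. *)
Lemma hess_coef_lim_dist k : `|hess_coef_lim - hess_coef beta k| <=
  hess_coef_lim * (5 * (k.+1%:R * beta ^+ k.+1)).
Proof.
case/andP: beta01 => b0 b1; have c0 := onem_gt0 beta01.
have l0 := hess_coef_lim_ge0.
have -> : hess_coef_lim - hess_coef beta k = hess_coef_lim * (1 - gamma beta k).
  by rewrite /hess_coef_lim /hess_coef; ring.
rewrite normrM ger0_norm// ler_wpM2l// /gamma.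
rewrite addnC -mulnS mul2n -addnn exprD.
have u0 := exprn_ge0 k.+1 b0; have u1 := exprn_ile1 k.+1 b0 (ltW b1).
have q0 : 0 <= (1 - beta) / (1 + beta) := divr_ge0 (ltW c0) (addr_ge0 ler01 b0).
have q1 : (1 - beta) / (1 + beta) <= 1.
  by rewrite ler_pdivrMr ?mul1r ?ltr_wpDr//; lra.
have m1 : 1 <= k.+1%:R :> R by rewrite ler1n.
set u := beta ^+ _ in u0 u1 *; set m := k.+1%:R in m1 *.
set q := _ / _ in q0 q1 *.
have mu : u <= m * u by rewrite ler_peMl.
have uu : u * u <= u by rewrite ler_piMr.
have mq : m * u * q <= m * u by rewrite ler_piMr// (le_trans u0).
have mq0 : 0 <= m * u * q by rewrite mulr_ge0// (le_trans u0).
have uu0 : 0 <= u * u by rewrite mulr_ge0.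
have -> : 1 - (1 - u * u - 4 * m * u * q) = u * u + 4 * (m * u * q) by ring.
by rewrite ger0_norm; lra.
Qed.

Lemma reduces_to_modified_lossP : reduces_to_modified_loss E beta T.
Proof.
move=> A cA eps eps0.
have [M [_ AM]] := compact_bounded cA.
have {}AM x : A x -> `|x| <= `|M| + 1.
  by apply: AM; rewrite (le_lt_trans (ler_norm M))// ltrDl.
have [BF BF0 bF] := ball_lipschitz_fin_bounded (`|M| + 1) (partial_ball_lipschitz E4).
have [BG BG0 bG] := ball_lipschitz_fin_bounded (`|M| + 1) (grad_hess_ball_lipschitz E4).
have l0 := hess_coef_lim_ge0.
have i0 : 0 <= (1 - beta)^-1 by rewrite invr_ge0 ltW// onem_gt0.
(* [Q] collects the coefficient errors times the bounds on the compact set, with h < T and the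
   factor p for the Euclidean norm. *)
pose Q := p%:R * ((1 - beta)^-1 * BF + T * (hess_coef_lim * 5) * BG).
have sc : (Q * (k.+1%:R * beta ^+ k.+1) @[k --> \oo] --> 0)%classic.
  rewrite -[X in (_ --> X)%classic](mulr0 Q); apply: cvgMr.
  by have := cvg_natmul_expr beta01; rewrite -(cvg_shiftS (fun n => n%:R * beta ^+ n)).
near=> k => h x /andP[h0 hT] Ax.
have Qk : Q * (k.+1%:R * beta ^+ k.+1) <= eps.
  by near: k; exact: cvgr_le _ sc _ eps0.
have xM := AM x Ax.
apply: le_trans _ Qk; rewrite (le_trans (norm2_le_norm _))// /Q -mulrA ler_wpM2l//.
have s0 : 0 <= k.+1%:R * beta ^+ k.+1.
  by rewrite mulr_ge0// exprn_ge0//; case/andP: beta01.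
set s := k.+1%:R * _ in s0 *.
rewrite piecewise_fieldE reduced_fieldE.
have -> : - grad_coef beta k *: grad E x - (h * hess_coef beta k) *: G x -
    (- (1 - beta)^-1 *: grad E x - (h * hess_coef_lim) *: G x) =
    ((1 - beta)^-1 - grad_coef beta k) *: grad E x +
    (h * (hess_coef_lim - hess_coef beta k)) *: G x.
  move: (grad E x) (G x) => f g.
  by apply/rowP => i; rewrite !mxE; ring.
rewrite (le_trans (ler_normD _ _))// mulrDl lerD// normrZ.
  rewrite mulrAC ler_pM ?grad_coef_lim//.
  by apply: norm_le_coord => // i; rewrite mxE bF.
have -> : T * (hess_coef_lim * 5) * BG * s = T * (hess_coef_lim * (5 * s)) * BG by ring.
rewrite ler_pM//.
  by rewrite normrM (gtr0_norm h0) ler_pM ?(ltW h0) ?(ltW hT) ?hess_coef_lim_dist.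
by apply: norm_le_coord => // i; rewrite bG.
Unshelve. all: by end_near. Qed.

End reduction.

(* Without the last hypothesis on [xt] the bound fails when the limiting flow
   blows up before time T, e.g. for E x = - x ^+ 4 in dimension 1, beta = 0. *)
Theorem theorem4p1 (R : realType) (p : nat) (E : 'rV[R]_p -> R)
    (beta T : R) (x0 : 'rV[R]_p)
    (E4 : times_differentiable 4 E) (beta01 : 0 <= beta < 1) (T0 : 0 < T) :
  (forall xt : R -> R -> 'rV[R]_p,
     (forall h, 0 < h < T -> piecewise_trajectory E beta T x0 h (xt h)) ->
     lipschitz_smooth E \/ uniformly_bounded T xt ->
     bigO_close 2 T (heavy_ball E beta x0) xt)
  /\ reduces_to_modified_loss E beta T.
Proof.
split=> [xt ode bnd|]; last exact: reduces_to_modified_lossP.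
apply: bounded_close => //; case: bnd => // lipE.
exact: (lipschitz_bounded E4 beta01 T0 lipE ode).
Qed.
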